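(* Let $p$ be an odd prime, $q=p^n\equiv 1\pmod 4$ and $q=4f+1$. Let $G=(\mathbb{F}_q,+)$ and let $w$ be a generator of $\mathbb{F}_q^*$, with cyclotomic classes $C_0,C_1,C_2,C_3$ of order $4$ defined from $w$. If $p\equiv -1\pmod 4$, let $s=(-p)^{n/2}$ and $t=0$. If $p\equiv 1\pmod 4$, let the integer $s$ be uniquely determined by $q=s^2+t^2$, $p\nmid s$, $s\equiv 1\pmod 4$, and let the integer $t$ be uniquely determined by $w^{(q-1)/4}\equiv s/t\pmod p$. If $P=C_i$ and $N=0_G$ with $i\in\{0,1,2,3\}$, then $D=P-N$ is a $\left(q,f+1,\frac{f-3}{4}\right)$-signed difference set if and only if $f\equiv 3\pmod 4$ and $s=5$.
   Context: The cyclotomic classes of order $4$ are $C_0=\{w^{4j}:0\le j\le f-1\}$ and $C_i=w^iC_0$ for $0\le i\le 3$. In the case $p\equiv 1\pmod 4$, $q=s^2+t^2$ is a representation in integers with $p\nmid s$, $s\equiv 1\pmod 4$ (this fixes $s$ and $|t|$), and the sign of $t$ is fixed by requiring that $w^{(q-1)/4}$, which lies in the prime field $\mathbb{F}_p$, equals $s/t$ in $\mathbb{F}_p$. For $G=(\mathbb{F}_q,+)$ with identity $0_G$, a subset $S\subseteq G$ is identified with $\sum_{s\in S}s$ in the group ring $\mathbb{Z}[G]$; $N=0_G$ means $N=\{0\}$. For disjoint subsets $P,N$ of $G$, the element $D=P-N$ is a signed set of size $k=|P|+|N|$. For $A=\sum_g a_g g\in\mathbb{Z}[G]$, $A^{-1}=\sum_g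 a_g g^{-1}$ with $g^{-1}$ the inverse of $g$ in $G$ (i.e. the field element $-g$). $D$ is a $(q,k,\lambda)$-signed difference set if $DD^{-1}=\lambda G+(k-\lambda)\cdot 0_G$ in $\mathbb{Z}[G]$, where $\lambda$ is an integer. *)

(* Defs.v *)
From HB Require Import structures.
From mathcomp Require Import all_boot all_order all_fingroup all_algebra all_solvable.

Set Implicit Arguments.
Unset Strict Implicit.
Unset Printing Implicit Defensive.

Import GRing.Theory.
Local Open Scope ring_scope.

(* An element of Z[G], G additive and finite, is the function giving its
   integer coefficients. The additive structure is the library's one on
   {ffun G -> int}; the library's product on this type is pointwise and is not
   the product of Z[G], hence [gr_mul]. *)
Definition gr_set (G : finZmodType) (S : {set G}) : {ffun G -> int} :=
  [ffun g => (g \in S)%:R].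

Definition gr_mul (G : finZmodType) (A B : {ffun G -> int}) : {ffun G -> int} :=
  [ffun g => \sum_(xy : G * G | xy.1 + xy.2 == g) A xy.1 * B xy.2].

(* A^{-1} = \sum_g a_g g^{-1}: the coefficient at g is the one of A at -g. *)
Definition gr_inv (G : finZmodType) (A : {ffun G -> int}) : {ffun G -> int} :=
  [ffun g => A (- g)].

Definition signed_set (G : finZmodType) (k : nat) (D : {ffun G -> int}) : Prop :=
  exists P N : {set G},
    [/\ [disjoint P & N], D = gr_set P - gr_set N & k = (#|P| + #|N|)%N].

Definition signed_difference_set (G : finZmodType) (v k : nat) (lambda : int)
    (D : {ffun G -> int}) : Prop :=
  [/\ #|G| = v, signed_set k D &
      gr_mul D (gr_inv D) =
        gr_set [set: G] *~ lambda + gr_set [set 0] *~ (k%:Z - lambda)].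

(* The classes of order 4 in a field with 4 f + 1 elements. *)
Definition cyclotomic_class (F : finFieldType) (w : {unit F}) (f i : nat) :
    {set F} :=
  [set FinRing.uval w ^+ i * x
     | x in [set FinRing.uval w ^+ (4 * j) | j : 'I_f]].

(* Main.v *)
Require Import Defs.
From HB Require Import structures.
From mathcomp Require Import all_boot all_order all_fingroup all_algebra all_solvable.
From mathcomp Require Import all_field zify ring.

Set Implicit Arguments.
Unset Strict Implicit.
Unset Printing Implicit Defensive.

Import Order.TTheory GRing.Theory Num.Theory.
Local Open Scope ring_scope.

(* Scaling g into the class shows that, for odd f, the coefficient of D D^{-1}
   at g <> 0 depends only on e = w^{if} / g^f, a fourth root of unity, and is
   M(e) - [e = 1] - [e = -1] with M(e) = #{y | y^f = (y + 1)^f = e}.  Moreover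
   M(-e) = M(e) and 2 (M(1) + M(w^f)) = f - 1, so everything is governed by M(1).
   With eta the quadratic character and S(g) = sum_x eta(x) eta(x^2 - g),
   counting fourth powers gives 16 M(1) = q - 7 + S(1), while Jacobsthal's
   identity is S(1)^2 + S(w)^2 = 4q.  Modulo p, S(1) is up to sign the binomial
   coefficient (2f choose f), hence nonzero; as the representation q = s^2 + t^2
   with p not dividing s and s = 1 mod 4 determines s, it follows that
   S(1) = 2s.  Thus lambda = (f - 3) / 4, that is 16 M(1) = 4 (f + 1), is
   equivalent to s = 5.  Integrality of lambda forces f = 3 mod 4, and f odd
   rules out p = 3 mod 4. *)

(** * Integer arithmetic: a binomial coefficient modulo p, and sums of two squares *)

(* Legendre's formula: the base p digits of f all equal (p - 1) / 4, so that
   doubling f produces no carry. *)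
Lemma ndvdn_bin_double (p n f : nat) :
  prime p -> p = 1 %[mod 4] -> (p ^ n = 4 * f + 1)%N -> ~~ (p %| 'C(2 * f, f))%N.
Proof.
move=> p_pr p1 pnE.
have p_gt1 := prime_gt1 p_pr.
have pX1 k : (p ^ k = 1 %[mod 4])%N by rewrite -modnXm p1 modnXm exp1n.
have divD k : (2 * f %/ p ^ k = f %/ p ^ k + f %/ p ^ k)%N.
  have pk_gt0 : (0 < p ^ k)%N by rewrite expn_gt0; lia.
  have [le_kn|lt_nk] := leqP k n; last first.
    have: (p ^ n < p ^ k)%N by rewrite ltn_exp2l.
    by move=> ?; rewrite !divn_small; lia.
  have pnE' : (p ^ n = p ^ k * p ^ (n - k))%N by rewrite -expnD subnKC.
  have pk1 := pX1 k; have pm1 := pX1 (n - k)%N.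
  have [e pkE] : exists e, (p ^ k = 4 * e + 1)%N.
    by exists (p ^ k %/ 4)%N; lia.
  have [h pmE] : exists h, (p ^ (n - k) = 4 * h + 1)%N.
    by exists (p ^ (n - k) %/ 4)%N; lia.
  (* Expanding 4f + 1 = (4h + 1)(4e + 1) shows that h and e are the quotient and remainder of f by
     p^k. As 2e < p^k, doubling f doubles the quotient. *)
  have fE : (f = h * p ^ k + e)%N.
    by move: pnE'; rewrite pnE pmE pkE; nia.
  have f2E : (2 * f = (2 * h) * p ^ k + 2 * e)%N by rewrite fE; ring.
  rewrite f2E {1 2}fE !divnMDl // !divn_small; lia.
have le_f2f : (f <= 2 * f)%N by lia.
have bin_gt0' : (0 < 'C(2 * f, f))%N by rewrite bin_gt0.
have := congr1 (logn p) (bin_fact le_f2f).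
have -> : (2 * f - f = f)%N by lia.
rewrite !lognM ?muln_gt0 ?fact_gt0 //.
(* All three factorials get the common summation bound 2f; the added terms vanish because m <
   p^k. *)
have logf m : (m <= 2 * f)%N ->
    logn p m`! = (\sum_(1 <= k < (2 * f).+1) m %/ p ^ k)%N.
  move=> le_m; rewrite logn_fact // [RHS](@big_cat_nat _ _ _ m.+1) //=.
  rewrite [X in (_ + X)%N]big_nat_cond [X in (_ + X)%N]big1 ?addn0 // => k.
  rewrite andbT => /andP[lt_mk _]; rewrite divn_small //.
  by rewrite (leq_trans lt_mk) // ltnW // ltn_expl.
rewrite !logf //= (eq_bigr _ (fun k _ => divD k)) big_split /= => logE.
have : logn p 'C(2 * f, f) = 0%N by lia.
by apply: contra_eqN => p_dvd; rewrite -lt0n logn_gt0 mem_primes p_pr bin_gt0'.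
Qed.

Lemma dvdz_sqr_sum_eq0 (q X Y : int) :
  0 < q -> (q %| X)%Z -> X ^+ 2 + Y ^+ 2 = q ^+ 2 -> X = 0 \/ Y = 0.
Proof.
move=> q_gt0 /dvdzP[m ->] XYE.
have [->|m_neq0] := eqVneq m 0; first by left; rewrite mul0r.
right; have : 1 <= m ^+ 2 by nia.
nia.
Qed.

(** Since (as - bt)(as + bt) = q(a^2 + s^2 - q), q divides as - bt. Then (as - bt)^2 + (at + bs)^2 =
    q^2 forces one of the two squares to vanish. *)
Lemma sqr_sum_eq_of_ndvdz (p n : nat) (a b s t : int) :
  prime p -> odd p -> (a = 1 %[mod 2])%Z -> (s = 1 %[mod 2])%Z ->
  a ^+ 2 + b ^+ 2 = (p ^ n)%N -> s ^+ 2 + t ^+ 2 = (p ^ n)%N ->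
  ~~ (p %| a * s + b * t)%Z -> a ^+ 2 = s ^+ 2.
Proof.
move=> p_pr p_odd a1 s1; set q : int := (p ^ n)%N => abE stE p_ndvd.
have q_gt0 : 0 < q by rewrite /q ltz_nat expn_gt0 prime_gt0.
have q1 : (q = 1 %[mod 2])%Z.
  rewrite /q; have := oddX p n; rewrite p_odd orbT; lia.
have bE : b ^+ 2 = q - a ^+ 2 by lia.
have tE : t ^+ 2 = q - s ^+ 2 by lia.
have q_dvd : (q %| a * s - b * t)%Z.
  suff: (q %| (a * s - b * t) * (a * s + b * t))%Z.
    rewrite Gauss_dvdzl // coprimezE /q /= coprimeXl //.
    by rewrite prime_coprime // -dvdzE in p_ndvd *.
  apply/dvdzP; exists (a ^+ 2 + s ^+ 2 - q).
  have -> : (a * s - b * t) * (a * s + b * t)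
            = a ^+ 2 * s ^+ 2 - b ^+ 2 * t ^+ 2 by ring.
  by rewrite bE tE; ring.
have normE : (a * s - b * t) ^+ 2 + (a * t + b * s) ^+ 2 = q ^+ 2.
  have -> : q ^+ 2 = (a ^+ 2 + b ^+ 2) * (s ^+ 2 + t ^+ 2).
    by rewrite abE stE.
  by ring.
(* The case as = bt gives a^2 + s^2 = q, impossible by parity; the case at = -bs gives the claim. *)
have [asE|atE] := dvdz_sqr_sum_eq0 q_gt0 q_dvd normE.
  have : (a * s) ^+ 2 = (b * t) ^+ 2 by rewrite (subr0_eq asE).
  rewrite !exprMn bE tE => E.
  have : a ^+ 2 + s ^+ 2 = q.
    apply: (mulfI (lt0r_neq0 q_gt0)).
    have -> : q * q = (q - a ^+ 2) * (q - s ^+ 2)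
                + q * (a ^+ 2 + s ^+ 2) - a ^+ 2 * s ^+ 2 by ring.
    by rewrite -E; ring.
  have [u aE] : exists u : int, a = 2 * u + 1.
    by exists (a %/ 2)%Z; clear -a1; lia.
  have [v sE] : exists v : int, s = 2 * v + 1.
    by exists (s %/ 2)%Z; clear -s1; lia.
  by rewrite aE sE; clear -q1; lia.
have : (a * t) ^+ 2 = (b * s) ^+ 2.
  by move/eqP: atE; rewrite addr_eq0 => /eqP->; rewrite sqrrN.
rewrite !exprMn bE tE => E; apply: (mulfI (lt0r_neq0 q_gt0)).
have -> : q * a ^+ 2 = a ^+ 2 * (q - s ^+ 2) + a ^+ 2 * s ^+ 2 by ring.
by rewrite E; ring.
Qed.

(* Modulo p the product (as + bt)(as - bt) vanishes, while the sum of its two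
   factors does not, so that q divides exactly one of them. *)
Lemma sqr_sum_uniq (p n : nat) (a b s t : int) :
  prime p -> odd p -> (a = 1 %[mod 4])%Z -> (s = 1 %[mod 4])%Z ->
  ~~ (p %| a)%Z -> ~~ (p %| s)%Z ->
  a ^+ 2 + b ^+ 2 = (p ^ n)%N -> s ^+ 2 + t ^+ 2 = (p ^ n)%N -> a = s.
Proof.
move=> p_pr p_odd a1 s1 pa ps abE stE.
suff: a ^+ 2 = s ^+ 2.
  by move=> /eqP; rewrite eqf_sqr => /orP[] /eqP; clear -a1 s1; lia.
have a1' : (a = 1 %[mod 2])%Z by clear -a1; lia.
have s1' : (s = 1 %[mod 2])%Z by clear -s1; lia.
have [pD|] := boolP (p %| a * s + b * t)%Z; last first.
  exact: sqr_sum_eq_of_ndvdz p_pr p_odd a1' s1' abE stE.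
apply: (@sqr_sum_eq_of_ndvdz p n a b s (- t)); rewrite ?sqrrN //.
apply/negP => pB; have := rpredD pD pB.
have -> : a * s + b * t + (a * s + b * - t) = 2 * (a * s) by ring.
have p2 : coprime p 2 by rewrite coprime_sym coprime2n.
rewrite Gauss_dvdzr ?coprimezE // dvdzE abszM Euclid_dvdM //.
by rewrite -!dvdzE (negPf pa) (negPf ps).
Qed.

(** * The quadratic character, computed on powers of a primitive root *)

Definition quad_char (F : finFieldType) (x : F) : int :=
  if x == 0 then 0 else if [exists y, y ^+ 2 == x] then 1 else -1.

Section QuadChar.
Variables (F : finFieldType) (f : nat) (z : F).
Hypotheses (cardF : #|F| = (4 * f + 1)%N) (zP : (4 * f).-primitive_root z).

Local Notation eta := (@quad_char F).

Lemma four_f_gt0 : (0 < 4 * f)%N. Proof. exact: prim_order_gt0 zP. Qed.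

Lemma f_gt0 : (0 < f)%N. Proof. by move: four_f_gt0; rewrite muln_gt0. Qed.

Lemma expf_card_pred (x : F) : x != 0 -> x ^+ (4 * f) = 1.
Proof.
by move=> x0; apply: (mulfI x0); rewrite -exprS -addn1 -cardF expf_card mulr1.
Qed.

Lemma prim_exp_onto (x : F) : x != 0 -> exists k, x = z ^+ k.
Proof. by move=> /expf_card_pred /(prim_rootP zP)[k ->]; exists k. Qed.

Lemma prim_neq0 : z != 0.
Proof.
by apply: contraTneq four_f_gt0 => z0; move: (prim_expr_order zP);
  rewrite z0 expr0n; case: eqP => [->//|_ /eqP]; rewrite eq_sym oner_eq0.
Qed.

Lemma prim_half : z ^+ (2 * f) = -1.
Proof.
have /eqP : (z ^+ (2 * f)) ^+ 2 = 1.
  by rewrite -exprM -(prim_expr_order zP); congr (_ ^+ _); lia.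
rewrite sqrf_eq1 => /orP[|/eqP //]; rewrite -(prim_order_dvd zP).
by move=> /dvdn_leq; have := f_gt0; lia.
Qed.

Lemma quad_char_prim (k : nat) : eta (z ^+ k) = (-1) ^+ k.
Proof.
rewrite /quad_char expf_eq0 (negPf prim_neq0) andbF -signr_odd.
case: existsP => [[y /eqP yE]|no_y].
  have y0 : y != 0.
    by apply: contra_eqN yE => /eqP->; rewrite expr0n eq_sym expf_neq0 ?prim_neq0.
  have [j yj] := prim_exp_onto y0; move/eqP: yE.
  rewrite yj -exprM (eq_prim_root_expr zP) => /eqP jk.
  suff -> : odd k = false by [].
  have /(congr1 odd) : (j * 2 = k %[mod 2])%N.
    by rewrite -(modn_dvdm k (_ : 2 %| 4 * f)%N) ?dvdn_mulr // -jk modn_dvdm ?dvdn_mulr.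
  by rewrite !modn2 !oddb oddM andbF.
case: (boolP (odd k)) => // k_even; case: no_y; exists (z ^+ k./2).
by rewrite -exprM muln2 halfK (negPf k_even) subn0.
Qed.

Lemma quad_char_gen : eta z = -1.
Proof. exact: quad_char_prim 1. Qed.

Lemma quad_char0 : eta 0 = 0. Proof. by rewrite /quad_char eqxx. Qed.

Lemma quad_char1 : eta 1 = 1.
Proof. by rewrite -(expr0 z) quad_char_prim. Qed.

Lemma quad_charM : {morph eta : x y / x * y}.
Proof.
move=> x y; have [->|x0] := eqVneq x 0; first by rewrite mul0r quad_char0 mul0r.
have [->|y0] := eqVneq y 0; first by rewrite mulr0 quad_char0 mulr0.
have [[i ->] [j ->]] := (prim_exp_onto x0, prim_exp_onto y0).
by rewrite -exprD !quad_char_prim exprD.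
Qed.

Lemma quad_char_sqr (x : F) : x != 0 -> eta x ^+ 2 = 1.
Proof.
by move=> /prim_exp_onto[k ->]; rewrite quad_char_prim sqrr_sign.
Qed.

Lemma quad_charX2 (x : F) : x != 0 -> eta (x ^+ 2) = 1.
Proof. by move=> x0; rewrite expr2 quad_charM -expr2 quad_char_sqr. Qed.

Lemma quad_charN (x : F) : eta (- x) = eta x.
Proof.
by rewrite -mulN1r quad_charM -prim_half quad_char_prim exprM sqrrN !expr1n mul1r.
Qed.

Lemma quad_char_exp (x : F) : (eta x)%:~R = x ^+ (2 * f) :> F.
Proof.
have [->|x0] := eqVneq x 0.
  by rewrite quad_char0 expr0n muln_eq0 /= (gtn_eqF f_gt0).
have [k ->] := prim_exp_onto x0; rewrite quad_char_prim rmorphXn /= rmorphN1.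
by rewrite -prim_half -!exprM mulnC.
Qed.

(** In characteristic 2, z^(2f) = -1 would equal 1, although z has order 4f. *)
Lemma oppr_neq (x : F) : x != 0 -> (- x == x) = false.
Proof.
move=> x0; apply/negbTE; rewrite eq_sym -addr_eq0 -mulr2n -mulr_natl mulf_neq0 //.
apply/eqP => two0; move: (esym prim_half) (prim_order_dvd zP (2 * f)).
rewrite -[X in X = _]addr0 -two0 addrC addrK => <-.
by rewrite eqxx => /dvdn_leq; have := f_gt0; lia.
Qed.

Lemma card_sqrt (x : F) : (#|[pred y | y ^+ 2 == x]|%:R : int) = 1 + eta x.
Proof.
have [->|x0] := eqVneq x 0.
  rewrite quad_char0 addr0 (@eq_card1 _ 0) // => y.
  by rewrite !inE sqrf_eq0.
rewrite /quad_char (negPf x0); case: existsP => [[y /eqP yE]|no_y].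
  rewrite (@eq_card _ _ (pred2 (- y) y)) => [|u]; last first.
    by rewrite !inE -yE eqf_sqr orbC.
  rewrite card2 oppr_neq //.
  by apply: contra_neqN x0 => /eqP y0; rewrite -yE y0 expr0n.
by rewrite eq_card0 // => y; apply/negP => yE; apply: no_y; exists y.
Qed.

(** * Sums of values of the quadratic character *)

Lemma sum_sqr (G : F -> int) : \sum_y G (y ^+ 2) = \sum_x (1 + eta x) * G x.
Proof.
rewrite (partition_big (fun y => y ^+ 2) predT) //=; apply: eq_bigr => x _.
rewrite (eq_bigr (fun _ => G x)) => [|y /eqP-> //].
by rewrite sumr_const -card_sqrt mulr_natl.
Qed.

Lemma sum_const1 : \sum_(x : F) (1 : int) = #|F|%:R.
Proof. by rewrite sumr_const cardT. Qed.

Lemma sum_quad_char : \sum_x eta x = 0.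
Proof.
have := sum_sqr (fun=> 1); under [RHS]eq_bigr do rewrite mulr1.
by rewrite big_split /= => /eqP; rewrite addrC -subr_eq subrr eq_sym => /eqP.
Qed.

Lemma sum_shift (c : F) (G : F -> int) : \sum_x G (x + c) = \sum_x G x.
Proof. by rewrite [RHS](reindex_inj (addIr c)). Qed.

(** For nonzero x the term is eta(1 + e/x), and 1 + e/x runs over all elements except 1; so the sum
    is the full sum 0 minus eta(1). *)
Lemma sum_quad_char_shift (e : F) : e != 0 ->
  \sum_x eta x * eta (x + e) = -1.
Proof.
move=> e0; rewrite (bigD1 0) //= quad_char0 mul0r add0r.
have inj_div : injective (fun x => e / x).
  by move=> x y /(mulfI e0) /invr_inj.
rewrite (eq_bigr (fun x => eta (1 + e / x))) => [|x x0]; last first.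
  have -> : x + e = x * (1 + e / x) by rewrite mulrDr mulr1 mulrCA divff ?mulr1.
  by rewrite quad_charM mulrA -expr2 quad_char_sqr ?mul1r.
rewrite (reindex_inj inj_div) /=.
rewrite (eq_big (fun u => u != 0) (fun u => eta (u + 1))) => [|u|u u0]; last 2 first.
- by rewrite mulf_eq0 invr_eq0 (negPf e0).
- by rewrite invf_div mulrCA divff ?mulr1 1?addrC.
apply: (addrI (eta (0 + 1))); rewrite add0r quad_char1 subrr.
by rewrite -[RHS]sum_quad_char -(sum_shift 1) [RHS](bigD1 0) //= add0r quad_char1.
Qed.

Lemma sum_quad_charB (c d : F) :
  \sum_g eta (c - g) * eta (d - g) = #|F|%:R * (c == d)%:R - 1.
Proof.
rewrite (reindex_inj (inj_comp (addIr c) oppr_inj)) /=.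
under eq_bigr => g _.
  rewrite opprD opprK addrCA subrr addr0.
  rewrite addrCA.
  over.
have [->|cd] := eqVneq c d; last first.
  by rewrite sum_quad_char_shift ?mulr0 ?add0r // subr_eq0 eq_sym.
rewrite mulr1 (bigD1 0) //= quad_char0 mul0r add0r.
rewrite (eq_bigr (fun=> 1)) => [|g g0]; last first.
  by rewrite subrr addr0 -expr2 quad_char_sqr.
by rewrite -sum_const1 [in RHS](bigD1 0) //= addrC addrK.
Qed.

(** * Jacobsthal sums and their second moment *)

(** For g nonzero this is, up to sign, the Frobenius trace of the curve y^2 = x^3 - gx. *)
Definition jacobsthal (g : F) : int := \sum_x eta x * eta (x ^+ 2 - g).
Local Notation S := jacobsthal.

Lemma jacobsthal0 : S 0 = 0.
Proof.
rewrite -[RHS]sum_quad_char; apply: eq_bigr => x _; rewrite subr0.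
have [->|x0] := eqVneq x 0; first by rewrite quad_char0 mul0r.
by rewrite quad_charX2 ?mulr1.
Qed.

(** Substitute ux for x. Consequently S(g)^2 depends only on the square class of g. *)
Lemma jacobsthalM (u g : F) : u != 0 -> S (u ^+ 2 * g) = eta u * S g.
Proof.
move=> u0; rewrite /S (reindex_inj (mulfI u0)) mulr_sumr /=.
apply: eq_bigr => x _.
rewrite exprMn -mulrBr quad_charM [eta (u ^+ 2 * _)]quad_charM quad_charX2 //.
by rewrite mul1r mulrA.
Qed.

(** After expanding the square, orthogonality ([sum_quad_charB]) keeps only y = x and y = -x. These
    contribute equally since eta is even, which gives 2q for each nonzero x. *)
Lemma sum_jacobsthal_sqr :
  \sum_g S g ^+ 2 = 2 * #|F|%:R * (#|F|%:R - 1).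
Proof.
have -> : \sum_g S g ^+ 2 = \sum_x \sum_y
    eta x * eta y * (#|F|%:R * (x ^+ 2 == y ^+ 2)%:R - 1).
  transitivity (\sum_g \sum_x \sum_y eta x * eta y *
      (eta (x ^+ 2 - g) * eta (y ^+ 2 - g))).
    apply: eq_bigr => g _; rewrite expr2 mulr_suml; apply: eq_bigr => x _.
    by rewrite mulr_sumr; apply: eq_bigr => y _; rewrite mulrACA.
  rewrite exchange_big; apply: eq_bigr => x _.
  rewrite exchange_big; apply: eq_bigr => y _.
  by rewrite -mulr_sumr sum_quad_charB.
transitivity (\sum_(x : F) 2 * #|F|%:R * (x != 0)%:R : int); last first.
  rewrite -mulr_sumr; congr (_ * _).
  rewrite -sum_const1 [in RHS](bigD1 0) //= [LHS](bigD1 0) //= eqxx add0r addrC addrK.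
  by apply: eq_bigr => x ->.
apply: eq_bigr => x _.
under eq_bigr => y _ do rewrite mulrBr mulr1.
rewrite big_split /= sumrN -mulr_sumr sum_quad_char mulr0 subr0.
have [->|x0] := eqVneq x 0.
  by rewrite mulr0 big1 // => y _; rewrite quad_char0 !mul0r.
rewrite mulr1 (bigD1 x) //= (bigD1 (- x)) /= ?oppr_neq // sqrrN !eqxx quad_charN.
rewrite -expr2 quad_char_sqr // !mul1r mulr1 big1 ?addr0 => [|y /andP[yx yNx]].
  by rewrite mulrDl mul1r.
by rewrite eq_sym eqf_sqr (negPf yx) (negPf yNx) !mulr0.
Qed.

(** The elements y^2 and z y^2 together cover F exactly twice, because z is a nonsquare. *)
Lemma sum_sqr_twist (G : F -> int) :
  \sum_y G (y ^+ 2) + \sum_y G (y ^+ 2 * z) = 2 * \sum_x G x.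
Proof.
rewrite sum_sqr (sum_sqr (fun x => G (x * z))) (reindex_inj (mulIf prim_neq0)) /=.
rewrite -big_split /= [in RHS](reindex_inj (mulIf prim_neq0)) /= mulr_sumr.
apply: eq_bigr => x _; rewrite -mulrDl quad_charM quad_char_gen.
by congr (_ * _); ring.
Qed.

(** In the second moment, each nonzero square contributes S(1)^2 and each nonsquare S(z)^2, while
    S(0) = 0. *)
Lemma jacobsthal_sqr_sum : S 1 ^+ 2 + S z ^+ 2 = 4 * #|F|%:R.
Proof.
have sumS (g : F) : \sum_y S (y ^+ 2 * g) ^+ 2 = (#|F|%:R - 1) * S g ^+ 2.
  rewrite (bigD1 0) //= expr0n mul0r jacobsthal0 expr0n add0r.
  rewrite (eq_bigr (fun=> 1 * S g ^+ 2)) => [|y y0]; last first.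
    by rewrite jacobsthalM // exprMn quad_char_sqr.
  rewrite -mulr_suml; congr (_ * _).
  by rewrite -sum_const1 [in RHS](bigD1 0) //= addrC addrK.
have := sum_sqr_twist (fun x => S x ^+ 2); rewrite sum_jacobsthal_sqr sumS.
under eq_bigr => y _ do rewrite -[y ^+ 2]mulr1.
rewrite sumS -mulrDr => E; have q1 : (#|F|%:R - 1 : int) != 0.
  by rewrite cardF natrD addrK pnatr_eq0 -lt0n four_f_gt0.
by apply: (mulfI q1); rewrite E; ring.
Qed.

(** * The Jacobsthal sum modulo p *)

Lemma card_natr0 : #|F|%:R = 0 :> F.
Proof.
have : \sum_(x : F) (x + 1) = \sum_x x by rewrite [RHS](reindex_inj (addIr 1)).
by rewrite big_split /= sumr_const -[RHS]addr0 => /addrI.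
Qed.

(** Replacing x by zx multiplies the sum by z^m, so it vanishes unless z^m = 1; in that case it is q
    - 1 = -1 in F. *)
Lemma sum_expr (m : nat) : (0 < m)%N ->
  \sum_(x : F) x ^+ m = - ((4 * f %| m)%N)%:R.
Proof.
move=> m_gt0; have [/dvdnP[k mE]|m_ndvd] := boolP (4 * f %| m)%N; last first.
  have : z ^+ m * (\sum_(x : F) x ^+ m) = \sum_(x : F) x ^+ m.
    rewrite [RHS](reindex_inj (mulfI prim_neq0)) mulr_sumr.
    by apply: eq_bigr => x _; rewrite exprMn.
  move=> /eqP; rewrite -subr_eq0 -[X in _ - X]mul1r -mulrBl mulf_eq0 subr_eq0.
  by rewrite -(prim_order_dvd zP) (negPf m_ndvd) oppr0 => /eqP.
rewrite (bigD1 0) //= expr0n (gtn_eqF m_gt0) add0r (eq_bigr (fun=> 1)) => [|x x0].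
  apply/eqP; rewrite -addr_eq0 addrC; apply/eqP.
  by rewrite -[RHS]card_natr0 -sumr_const [in RHS](bigD1 0).
by rewrite mE mulnC exprM expf_card_pred ?expr1n.
Qed.

(** Euler's criterion and the binomial theorem turn S(1) into power sums. The exponents lie between
    2f and 6f, so only 4f survives, at i = f. *)
Lemma jacobsthal_natr :
  (S 1)%:~R = - ((-1) ^+ f * ('C(2 * f, f))%:R) :> F.
Proof.
rewrite rmorph_sum /=.
transitivity (\sum_(x : F) \sum_(i < (2 * f).+1)
    (-1) ^+ i * ('C(2 * f, i))%:R * x ^+ (2 * f + 2 * (2 * f - i))).
  apply: eq_bigr => x _; rewrite rmorphM /= !quad_char_exp exprBn mulr_sumr.
  apply: eq_bigr => i _; rewrite expr1n mulr1 -exprM exprD -mulr_natr.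
  by ring.
rewrite exchange_big /=.
have lt_f : (f < (2 * f).+1)%N by lia.
rewrite (bigD1 (Ordinal lt_f)) //= [X in _ + X]big1 ?addr0 => [|i i_neq].
  rewrite -mulr_sumr sum_expr; last by have := f_gt0; lia.
  have -> : (2 * f + 2 * (2 * f - f) = 4 * f)%N by lia.
  by rewrite dvdnn mulrN mulr1.
rewrite -mulr_sumr sum_expr; last by have := f_gt0; lia.
case: dvdnP => [[k kE]|_]; last by rewrite oppr0 mulr0.
case/eqP: i_neq; apply: val_inj => /=; have lt_i := ltn_ord i.
have := f_gt0; case: k kE => [|[|k]] kE; nia.
Qed.

(** * Fourth powers and diagonal cyclotomic numbers *)

Lemma quad_char_indic (x : F) :
  1 + eta x = 2 * (x ^+ (2 * f) == 1)%:R + (x == 0)%:R.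
Proof.
have [->|x0] := eqVneq x 0.
  rewrite quad_char0 expr0n muln_eq0 /= (gtn_eqF f_gt0) eq_sym oner_eq0.
  by rewrite mulr0 add0r addr0.
have [k ->] := prim_exp_onto x0; rewrite quad_char_prim -exprM mulnC exprM.
rewrite prim_half addr0 -!(signr_odd _ k); case: (odd k); rewrite ?eqxx //.
by rewrite oppr_neq ?oner_eq0 // mulr0.
Qed.

(** Nonzero fourth powers are the v with v^f = 1, each having four fourth roots; two uses of
    [sum_sqr] give the count. *)
Lemma sum_expr4 (G : F -> int) :
  \sum_y G (y ^+ 4) = G 0 + 4 * \sum_v (v ^+ f == 1)%:R * G v.
Proof.
under eq_bigr => y _ do rewrite (exprM y 2 2).
rewrite (sum_sqr (fun v => G (v ^+ 2))).
under eq_bigr => x _ do rewrite quad_char_indic mulrDl.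
rewrite big_split /= addrC; congr (_ + _).
  rewrite (bigD1 0) //= eqxx mul1r expr0n big1 ?addr0 // => x /negPf->.
  by rewrite mul0r.
have := sum_sqr (fun v => (v ^+ f == 1)%:R * G v).
under [in X in X = _ -> _]eq_bigr => x _ do rewrite -exprM.
under [in X in _ -> X = _]eq_bigr => x _ do rewrite -mulrA.
rewrite -mulr_sumr => ->; rewrite mulr_sumr [RHS]mulr_sumr.
apply: eq_bigr => v _; have [vf|_] := eqVneq (v ^+ f) 1; last by rewrite !mul0r !mulr0.
rewrite quad_char_indic mulnC exprM vf expr1n eqxx.
have [v0|_] := eqVneq v 0; last by rewrite addr0 mulr1 mulrA.
by move/eqP: vf; rewrite v0 expr0n (gtn_eqF f_gt0) eq_sym oner_eq0.
Qed.

(* The diagonal cyclotomic number attached to the class {y | y^f = c}. *)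
Definition class_pairs (c : F) : int :=
  \sum_y ((y ^+ f == c) && ((y + 1) ^+ f == c))%:R.

Hypothesis f_odd : odd f.

Lemma exprN_odd (x : F) : (- x) ^+ f = - x ^+ f.
Proof. by rewrite exprNn -signr_odd f_odd mulN1r. Qed.

(** The substitution y -> -y - 1 exchanges y and y + 1 up to sign, and f is odd. *)
Lemma class_pairsN (c : F) : class_pairs (- c) = class_pairs c.
Proof.
rewrite /class_pairs (reindex_inj (inj_comp (addIr (-1)) oppr_inj)) /=.
apply: eq_bigr => y _; rewrite addrNK -opprD !exprN_odd !eqr_opp.
by rewrite andbC.
Qed.

(** Substitute -1/(y + 1) for y, so that y + 1 becomes y/(y + 1). This lets 2 M(1) be written as a
    count in which one f-th power is fixed only up to sign. *)
Lemma class_pairs_swap :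
  \sum_(y : F) ((y ^+ f == -1) && ((y + 1) ^+ f == 1))%:R = class_pairs 1.
Proof.
(* With the convention 0^-1 = 0 this is injective on all of F; y = -1 contributes 0 to both
   sides. *)
have inj_phi : injective (fun y : F => - (y + 1)^-1).
  by move=> x y /oppr_inj /invr_inj /addIr.
rewrite (reindex_inj inj_phi); apply: eq_bigr => y _; congr (_%:R).
rewrite exprN_odd exprVn eqr_opp invr_eq1 andbC.
have [y1|//] := eqVneq ((y + 1) ^+ f) 1; last by rewrite !andbF.
have y1_neq0 : y + 1 != 0.
  by apply: contra_eqN y1 => /eqP->; rewrite expr0n (gtn_eqF f_gt0) eq_sym oner_eq0.
have -> : - (y + 1)^-1 + 1 = y / (y + 1).
  by apply: (mulIf y1_neq0); rewrite divfK // mulrDl mulNr mulVf // mul1r addrC addrK.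
by rewrite exprMn exprVn y1 invr1 mulr1.
Qed.

(** Doubling by [class_pairs_swap] counts the fourth powers v for which v - 1 is a nonzero square.
    The constant 7 is 1 + 4 + 2: from the sum of eta(x^2 - 1), from the roots of y^4 = 1, and from
    [G 0]. *)
Lemma class_pairs1 : 16 * class_pairs 1 = #|F|%:R - 7 + S 1.
Proof.
have two_cp : 2 * class_pairs 1 =
    \sum_(v : F) (v ^+ f == 1)%:R * ((v - 1) ^+ (2 * f) == 1)%:R.
  have -> : 2 * class_pairs 1 = class_pairs 1 + class_pairs 1 by ring.
  rewrite -[X in _ + X]class_pairs_swap -big_split /=.
  rewrite [RHS](reindex_inj (addIr 1)); apply: eq_bigr => y _; rewrite addrK.
  rewrite mulnC exprM sqrf_eq1.
  have N1 : (1 == -1 :> F) = false by rewrite eq_sym oppr_neq ?oner_eq0.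
  case: (eqVneq (y ^+ f) 1) => [->|_]; rewrite ?N1 /= ?addr0 ?mulr1 ?add0r //.
  by rewrite -natrM mulnb andbC.
(* Twice the indicator that v - 1 is a nonzero square. *)
pose G v : int := 1 + eta (v - 1) - (v == 1)%:R.
have GE v : 2 * ((v - 1) ^+ (2 * f) == 1)%:R = G v.
  by rewrite /G quad_char_indic subr_eq0 addrK.
have -> : 16 * class_pairs 1 = 4 * \sum_v (v ^+ f == 1)%:R * G v.
  have -> : 16 * class_pairs 1 = 4 * (2 * (2 * class_pairs 1)) by ring.
  rewrite two_cp; congr (_ * _); rewrite mulr_sumr; apply: eq_bigr => v _.
  by rewrite -GE mulrCA.
have -> : 4 * \sum_v (v ^+ f == 1)%:R * G v = \sum_y G (y ^+ 4) - G 0.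
  by rewrite sum_expr4 addrAC subrr add0r.
have -> : G 0 = 2.
  by rewrite /G sub0r quad_charN quad_char1 eq_sym oner_eq0 subr0.
rewrite sumrB big_split /= sum_const1.
have -> : \sum_(y : F) (y ^+ 4 == 1)%:R = 4 :> int.
  rewrite (sum_expr4 (fun v => (v == 1)%:R)) eq_sym oner_eq0 add0r.
  rewrite (bigD1 1) //= expr1n !eqxx big1 ?addr0 // => v /negPf->.
  by rewrite mulr0.
have -> : \sum_y eta (y ^+ 4 - 1) = S 1 - 1.
  under eq_bigr => y _ do rewrite (exprM y 2 2).
  rewrite (sum_sqr (fun x => eta (x ^+ 2 - 1))).
  under eq_bigr => x _ do rewrite mulrDl mul1r.
  rewrite big_split /= addrC; congr (_ + _).
  transitivity (\sum_g eta (1 - g) * eta (-1 - g)).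
    apply: eq_bigr => x _; rewrite -quad_charM; congr eta.
    by ring.
  by rewrite sum_quad_charB eq_sym oppr_neq ?oner_eq0 // mulr0 add0r.
by ring.
Qed.

Lemma prim_quarter_sqr : (z ^+ f) ^+ 2 = -1.
Proof. by rewrite -exprM mulnC prim_half. Qed.

Lemma prim_expf_cases (y : F) : y != 0 ->
  [|| y ^+ f == 1, y ^+ f == -1, y ^+ f == z ^+ f | y ^+ f == - z ^+ f].
Proof.
move=> /expf_card_pred; rewrite mulnC (exprM y f (2 * 2)) (exprM _ 2 2) => /eqP.
rewrite sqrf_eq1 -[in X in _ || X]prim_quarter_sqr eqf_sqr sqrf_eq1.
by case/orP => /orP[] ->; rewrite ?orbT.
Qed.

Lemma prim_quarter_uniq : uniq [:: 1; -1; z ^+ f; - z ^+ f].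
Proof.
have N1 : (-1 == 1 :> F) = false by rewrite oppr_neq ?oner_eq0.
have z1 : (1 == z ^+ f) = false.
  by apply: contraFF N1 => /eqP e; rewrite -prim_quarter_sqr -e expr1n.
have zN1 : (-1 == z ^+ f) = false.
  by apply: contraFF N1 => /eqP e; rewrite -{1}prim_quarter_sqr -e sqrrN expr1n.
rewrite /= !inE !negb_or -!eqr_oppLR opprK N1 z1 zN1 andbT /=.
by rewrite oppr_neq ?expf_neq0 ?prim_neq0.
Qed.

Lemma sum_expf_eq1 : \sum_(x : F) (x ^+ f == 1)%:R = f%:R :> int.
Proof.
have := sum_expr4 (fun=> 1); rewrite sum_const1 cardF.
under [in X in _ = X -> _]eq_bigr => v _ do rewrite mulr1.
by rewrite natrD natrM addrC => /addrI /mulfI <-.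
Qed.

Lemma class_pairs_neq0 (c : F) : c != 0 -> class_pairs c =
  \sum_(y | y != 0) ((y ^+ f == c) && ((y + 1) ^+ f == c))%:R.
Proof.
move=> c0; rewrite /class_pairs (bigD1 0) //= expr0n (gtn_eqF f_gt0).
by rewrite eq_sym (negPf c0) add0r.
Qed.

(** Over the four classes one counts the y with y^f = (y + 1)^f. Dividing by y and inverting leaves
    the solutions of v^f = 1 other than v = 1. *)
Lemma class_pairs_sum :
  2 * (class_pairs 1 + class_pairs (z ^+ f)) = f%:R - 1.
Proof.
have -> : 2 * (class_pairs 1 + class_pairs (z ^+ f)) =
    class_pairs 1 + class_pairs (-1) +
    (class_pairs (z ^+ f) + class_pairs (- z ^+ f)).
  by rewrite !class_pairsN; ring.
have zf0 : z ^+ f != 0 by rewrite expf_neq0 ?prim_neq0.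
rewrite !class_pairs_neq0 ?oppr_eq0 ?oner_eq0 //.
rewrite -!big_split /=.
transitivity (\sum_(y : F | y != 0) ((y + 1) ^+ f == y ^+ f)%:R : int).
  apply: eq_bigr => y /prim_expf_cases; move: prim_quarter_uniq.
  rewrite /= !inE !negb_or => /and4P[/and3P[n12 n13 n14] /andP[n23 n24] n34 _].
  have neqF (a b : F) : a != b -> ((a == b) = false) * ((b == a) = false).
    by move=> ab; split; [exact: negbTE | rewrite eq_sym; exact: negbTE].
  case/or4P => /eqP->; rewrite eqxx ?(neqF _ _ n12, neqF _ _ n13, neqF _ _ n14,
    neqF _ _ n23, neqF _ _ n24, neqF _ _ n34) /= ?addr0 ?add0r //.
have inv_inj : injective (fun x : F => x^-1) by exact: invr_inj.
transitivity (\sum_(x : F | x != 0) ((x + 1) ^+ f == 1)%:R : int).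
  rewrite (reindex_inj inv_inj) /=; apply: eq_big => x; first by rewrite invr_eq0.
  move=> x0; congr (_%:R).
  have xf0 : x^-1 ^+ f != 0 by rewrite expf_neq0.
  have -> : x^-1 + 1 = (x + 1) / x.
    by rewrite mulrDl mul1r divff 1?addrC // -invr_eq0.
  by rewrite exprMn -[X in _ == X]mul1r (inj_eq (mulIf xf0)).
have := sum_expf_eq1; rewrite -(sum_shift 1) (bigD1 0) //= add0r expr1n eqxx => <-.
by rewrite addrAC subrr add0r.
Qed.
End QuadChar.

(** * Cyclotomic classes as fibres of the f-th power map *)

Lemma generator_prim_root (F : finFieldType) (w : {unit F}) :
  generator [set: {unit F}] w -> #|F|.-1.-primitive_root (FinRing.uval w).
Proof.
rewrite /generator => /eqP w_gen.
have uvalX k : FinRing.uval w ^+ k = FinRing.uval (w ^+ k)%g.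
  by rewrite FinRing.val_unitX.
have ord_w : #[w]%g = #|F|.-1 by rewrite orderE -w_gen card_finField_unit.
apply/andP; split; first by rewrite -ord_w order_gt0.
apply/forallP => k; rewrite unity_rootE uvalX.
move: (nat_of_ord k) (ltn_ord k) => m; rewrite -ord_w => lt_m.
rewrite -[1](FinRing.val_unit1 F) (inj_eq val_inj) -order_dvdn eqn_leq lt_m /=.
apply/eqP; apply/idP/idP => [/dvdn_leq -> //|le_wm].
by have -> : m.+1 = #[w]%g by apply/eqP; rewrite eqn_leq lt_m.
Qed.

Section Classes.
Variables (F : finFieldType) (f : nat) (w : {unit F}).
Hypotheses (cardF : #|F| = (4 * f + 1)%N).
Local Notation z := (FinRing.uval w).
Hypothesis zP : (4 * f).-primitive_root z.

(** If x and z^i have the same f-th power, then x/z^i is a z^k with 4 dividing k, as z has order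
    4f. *)
Lemma cyclotomic_classE (i : nat) :
  cyclotomic_class w f i = [set x | x ^+ f == z ^+ i ^+ f].
Proof.
have f_gt0 := f_gt0 zP; apply/setP => x; rewrite inE; apply/imsetP/eqP.
  move=> [_ /imsetP[j _ ->] ->]; rewrite exprMn -[_ ^+ (4 * j) ^+ f]exprM.
  by rewrite mulnAC exprM (prim_expr_order zP) expr1n mulr1.
move=> xf; have x0 : x != 0.
  apply: contra_eqN xf => /eqP->; rewrite expr0n (gtn_eqF f_gt0) eq_sym.
  by rewrite !expf_neq0 ?(prim_neq0 zP).
have u0 : x / z ^+ i != 0 by rewrite mulf_neq0 // invr_eq0 expf_neq0 ?(prim_neq0 zP).
have [k kE] := prim_exp_onto cardF zP u0.
have /dvdnP[j kE'] : (4 %| k)%N.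
  have /eqP : (z ^+ k) ^+ f = 1.
    by rewrite -kE exprMn exprVn xf divff // !expf_neq0 ?(prim_neq0 zP).
  by rewrite -exprM -(prim_order_dvd zP) dvdn_pmul2r.
exists (x / z ^+ i); last first.
  by rewrite mulrC divfK // expf_neq0 ?(prim_neq0 zP).
apply/imsetP; exists (Ordinal (ltn_pmod j f_gt0)) => //=.
by rewrite kE kE' mulnC -(prim_expr_mod zP) -muln_modr.
Qed.

Lemma card_cyclotomic_class (i : nat) : odd f -> #|cyclotomic_class w f i| = f.
Proof.
move=> f_odd; have z0 := prim_neq0 zP.
apply/eqP; rewrite -(eqr_nat int) -(sum_expf_eq1 cardF zP) cyclotomic_classE.
rewrite -sum1_card natr_sum big_mkcond (reindex_inj (mulfI (expf_neq0 i z0))) /=.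
apply/eqP; apply: eq_bigr => x _; rewrite inE exprMn.
rewrite -[X in _ == X]mulr1 (inj_eq (mulfI (expf_neq0 f (expf_neq0 i z0)))).
by case: eqP.
Qed.
End Classes.

(** * The coefficients of D D^{-1} *)

Lemma ffunMzE (T : finType) (A : {ffun T -> int}) (m : int) (x : T) :
  (A *~ m) x = A x * m.
Proof.
case: m => n; rewrite ?NegzE ?mulrNz ?ffunE -?pmulrn ffunMnE -mulr_natr natz ?mulrN //.
Qed.

Lemma gr_mul_inv (G : finZmodType) (A : {ffun G -> int}) (g : G) :
  gr_mul A (gr_inv A) g = \sum_x A x * A (x - g).
Proof.
rewrite ffunE (reindex_onto (fun x => (x, g - x)) fst) /=.
  apply: eq_big => [x|x _]; first by rewrite addrC subrK !eqxx.
  by rewrite ffunE opprB.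
by case=> x y /= /eqP <-; rewrite addrAC subrr add0r.
Qed.

Section Difference.
Variables (F : finFieldType) (f : nat) (z c : F) (P : {set F}).
Hypotheses (cardF : #|F| = (4 * f + 1)%N) (zP : (4 * f).-primitive_root z).
Hypotheses (f_odd : odd f) (c_neq0 : c != 0).
Hypothesis P_def : P = [set x | x ^+ f == c].
Local Notation D := (gr_set P - gr_set [set 0]).

Lemma class_diffE (x : F) : D x = (x ^+ f == c)%:R - (x == 0)%:R.
Proof. by rewrite P_def !ffunE !inE. Qed.

Lemma expf_eq_neq0 (x : F) : x ^+ f == c -> x != 0.
Proof.
apply: contraL => /eqP->.
by rewrite expr0n (gtn_eqF (f_gt0 zP)) eq_sym.
Qed.

Lemma class_diff_coef0 : gr_mul D (gr_inv D) 0 = #|P|%:R + 1.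
Proof.
rewrite gr_mul_inv.
transitivity (\sum_x ((x \in P)%:R + (x == 0)%:R) : int).
  apply: eq_bigr => x _; rewrite subr0 class_diffE P_def inE.
  have [/expf_eq_neq0/negPf->|_] := boolP (x ^+ f == c); first by [].
  by case: eqP.
rewrite big_split /= -sum1_card natr_sum; congr (_ + _).
  by rewrite [RHS]big_mkcond; apply: eq_bigr => x _; case: ifP.
by rewrite (bigD1 0) //= eqxx big1 ?addr0 // => x /negPf->.
Qed.

(** Put x = (y + 1)g, so that x - g = yg. The two corrections are the terms x = g and x = 0, where
    one factor is the coefficient -1 of D at 0. *)
Lemma class_diff_coef (g : F) : g != 0 ->
  gr_mul D (gr_inv D) g =
    class_pairs f (c / g ^+ f) - (c / g ^+ f == 1)%:R - (c / g ^+ f == -1)%:R.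
Proof.
move=> g0; have gf0 : g ^+ f != 0 by rewrite expf_neq0.
have divE (x : F) : (x == c / g ^+ f) = (x * g ^+ f == c).
  by rewrite -(inj_eq (mulIf gf0)) divfK.
rewrite [_ == 1]eq_sym [_ == -1]eq_sym !divE mul1r mulN1r -exprN_odd //.
rewrite gr_mul_inv.
transitivity (\sum_x (((x ^+ f == c) && ((x - g) ^+ f == c))%:R
   - (x == 0)%:R * ((- g) ^+ f == c)%:R - (x == g)%:R * (g ^+ f == c)%:R) : int).
  apply: eq_bigr => x _; rewrite !class_diffE subr_eq0.
  have [->|x0] := eqVneq x 0.
    rewrite sub0r [0 == g]eq_sym (negPf g0).
    case: eqP => [/eqP/expf_eq_neq0|_]; first by rewrite eqxx.
    by do 2!case: (_ == c).
  have [->|xg] := eqVneq x g.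
    rewrite subrr; case: (0 ^+ f =P c) => [/eqP/expf_eq_neq0|_]; first by rewrite eqxx.
    by do 2!case: (_ == c).
  by do 4!case: (_ == c).
rewrite !sumrB -!mulr_suml.
have sum1 (a : F) : \sum_x (x == a)%:R = 1 :> int.
  by rewrite (bigD1 a) //= eqxx big1 ?addr0 // => x /negPf->.
rewrite !sum1 !mul1r addrAC; congr (_ - _ - _).
have inj_h : injective (fun y => (y + 1) * g) by move=> x y /(mulIf g0) /addIr.
rewrite (reindex_inj inj_h); apply: eq_bigr => y _; rewrite !divE andbC.
by rewrite -!exprMn mulrDl mul1r addrK.
Qed.
End Difference.

(** * Identification of the Jacobsthal sum with 2s, and the equivalence *)

Lemma jacobsthal_eq (p n f : nat) (F : finFieldType) (z : F) (s t : int) :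
  prime p -> odd p -> p = 1 %[mod 4] -> #|F| = (p ^ n)%N ->
  #|F| = (4 * f + 1)%N -> (4 * f).-primitive_root z -> odd f ->
  (p ^ n)%N = s ^+ 2 + t ^+ 2 :> int -> ~~ (p %| s)%Z -> (s = 1 %[mod 4])%Z ->
  jacobsthal (1 : F) = 2 * s.
Proof.
move=> p_pr p_odd p1 cardFp cardF zP f_odd stE ps s1.
have qE : (p ^ n = 4 * f + 1)%N by rewrite -cardFp.
have SF := jacobsthal_natr cardF zP.
have pcharF : p \in [pchar F] by exact: card_finPcharP cardFp p_pr.
have pS : ~~ (p %| jacobsthal (1%R : F))%Z.
  apply/negP => /dvdzP[k kE]; move/eqP: SF; rewrite kE rmorphM /=.
  rewrite -pmulrn (pcharf0 pcharF) mulr0 eq_sym oppr_eq0 mulf_eq0 signr_eq0 /=.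
  by rewrite -(dvdn_pcharf pcharF) (negPf (ndvdn_bin_double p_pr p1 qE)).
have S16 := class_pairs1 cardF zP f_odd.
have S2 := jacobsthal_sqr_sum cardF zP.
move: S16 S2; rewrite cardF !natz.
set M := class_pairs _ _; set S := jacobsthal 1 in pS *; set T := jacobsthal z.
(* This is half of S = 16M - 4f + 6; oddness of f makes it 1 modulo 4. *)
move=> S16 S2; pose a := 8 * M - 2 * f%:Z + 3.
have Sa : S = 2 * a by rewrite /a; clear -S16; lia.
have a1 : (a = 1 %[mod 4])%Z by rewrite /a; clear -f_odd; lia.
have [b Tb] : exists b : int, T = 2 * b.
  have T2 : T ^+ 2 = 4 * ((4 * f + 1)%N%:Z - a ^+ 2).
    by apply: (addrI (S ^+ 2)); rewrite S2 Sa; ring.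
  have : (2 %| T ^+ 2)%Z by rewrite T2 dvdz_mulr.
  rewrite dvdzE abszX Euclid_dvdX // andbT => /dvdzP[b ->].
  by exists b; rewrite mulrC.
have abE : a ^+ 2 + b ^+ 2 = (p ^ n)%N.
  rewrite qE; apply: (@mulfI _ 4) => //; rewrite -S2 Sa Tb; ring.
have pa : ~~ (p %| a)%Z by apply: contra pS => pa; rewrite Sa dvdz_mull.
by rewrite Sa (sqr_sum_uniq p_pr p_odd a1 s1 pa ps abE (esym stE)).
Qed.

(** Odd f means q = 5 mod 8. Odd squares are 1 mod 8, so n is odd and p = q mod 8. *)
Lemma prime_mod4_of_odd (p n f : nat) :
  odd p -> (p ^ n = 4 * f + 1)%N -> odd f -> p = 1 %[mod 4].
Proof.
move=> p_odd qE f_odd; have [m [pE|pE]] : exists m, (p = 4 * m + 1 \/ p = 4 * m + 3)%N.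
- by exists (p %/ 4)%N; lia.
- by rewrite pE; lia.
have p2 : (p ^ 2 = 1 %[mod 8])%N.
  have -> : (p ^ 2 = (2 * m ^ 2 + 3 * m + 1) * 8 + 1)%N by rewrite pE; ring.
  by rewrite modnMDl.
have pX : (p ^ n = p ^ odd n %[mod 8])%N.
  rewrite -{1}(odd_double_half n) expnD -mul2n expnM -modnMmr -modnXm p2 modnXm.
  by rewrite exp1n modnMmr muln1.
move: pX; rewrite qE; case: (odd n); rewrite ?expn0 ?expn1 ?pE; clear -f_odd; lia.
Qed.

Theorem proposition5p7 (p n q f : nat) (F : finFieldType) (w : {unit F})
    (s t : int) (i : 'I_4) (P N : {set F})
    (p_prime : prime p) (p_odd : odd p)
    (q_def : q = (p ^ n)%N) (q_mod4 : q = 1 %[mod 4])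
    (q_f : q = (4 * f + 1)%N)
    (card_F : #|F| = q)
    (w_gen : generator [set: {unit F}] w)
    (st_3mod4 : (p%:Z = -1 %[mod 4])%Z ->
       s = (- p%:Z) ^+ (n %/ 2) /\ t = 0)
    (st_1mod4 : (p%:Z = 1 %[mod 4])%Z ->
       [/\ q%:Z = s ^+ 2 + t ^+ 2, ~~ (p%:Z %| s)%Z, (s = 1 %[mod 4])%Z
         & FinRing.uval w ^+ ((q - 1) %/ 4) = s%:~R / t%:~R :> F])
    (P_def : P = cyclotomic_class w f i)
    (N_def : N = [set 0]) :
  (exists lambda : int, lambda%:Q = (f%:Q - 3) / 4 /\
     signed_difference_set q (f + 1) lambda (gr_set P - gr_set N))
  <-> (f = 3 %[mod 4]) /\ s = 5.
Proof.
rewrite -card_F in q_f.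
have zP : (4 * f).-primitive_root (FinRing.uval w).
  by have := generator_prim_root w_gen; rewrite q_f addn1.
have qE : (p ^ n = 4 * f + 1)%N by rewrite -q_def -card_F.
set z := FinRing.uval w in zP st_1mod4 *.
have JE : (f = 3 %[mod 4])%N ->
    [/\ odd f, jacobsthal (1 : F) = 2 * s & 16 * class_pairs f (1 : F) = 4 * f%:Z - 6 + 2 * s].
  move=> f3; have f_odd : odd f by clear -f3; lia.
  have p1 := prime_mod4_of_odd p_odd qE f_odd.
  have p1Z : (p%:Z = 1 %[mod 4])%Z by clear -p1; lia.
  have [stE ps s1 _] := st_1mod4 p1Z.
  have S2 : jacobsthal (1 : F) = 2 * s.
    apply: (jacobsthal_eq p_prime p_odd p1 _ q_f zP f_odd _ ps s1 (t := t) (n := n)).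
      by rewrite card_F.
    by rewrite -q_def.
  split=> //; rewrite (class_pairs1 q_f zP f_odd) S2 q_f natz; clear; lia.
have lamE (lambda : int) : lambda%:Q = (f%:Q - 3) / 4 <-> 4 * lambda = f%:Z - 3.
  split=> [lamE|lamE].
    apply: (@intr_inj rat); rewrite rmorphM rmorphB /= lamE.
    by rewrite mulrC divfK.
  have -> : f%:Q - 3 = (4 * lambda)%:~R by rewrite lamE rmorphB.
  by rewrite rmorphM /= mulrAC divff ?mul1r.
have PE : P = [set x | x ^+ f == z ^+ i ^+ f].
  by rewrite P_def (cyclotomic_classE q_f zP).
have z0 : z != 0 by exact: prim_neq0 zP.
have c0 : z ^+ i ^+ f != 0 by rewrite !expf_neq0.
rewrite N_def; set D := gr_set P - _.
have rhsE lambda (g : F) :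
    (gr_set [set: F] *~ lambda + gr_set [set 0] *~ ((f + 1)%N%:Z - lambda)) g
    = lambda + (g == 0)%:R * ((f + 1)%N%:Z - lambda).
  by rewrite ffunE !ffunMzE !ffunE !inE mul1r.
have N1 : (-1 == 1 :> F) = false.
  by rewrite (oppr_neq q_f zP) ?oner_eq0.
split=> [[lambda [/lamE lam4 [_ _ DE]]]|[f3 s5]].
  have f3 : (f = 3 %[mod 4])%N by clear -lam4; lia.
  have [f_odd _ M1] := JE f3; split=> //.
  (* At g = z^i one has e = 1, so the coefficient reads lambda = M(1) - 1; comparison with 16 M(1) =
     4f - 6 + 2s yields s = 5. *)
  have := congr1 (fun A : {ffun F -> int} => A (z ^+ i)) DE.
  rewrite rhsE (class_diff_coef zP f_odd c0 PE) ?expf_neq0 // divff //.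
  rewrite eqxx eq_sym N1 expf_eq0 (negPf z0) andbF mul0r subr0 addr0.
  move=> /eqP; rewrite subr_eq => /eqP M1'; move: M1; rewrite M1' /=.
  by clear -lam4; lia.
have [f_odd _ M1] := JE f3.
have [lambda lam4] : exists lambda : int, 4 * lambda = f%:Z - 3.
  by exists ((f%:Z - 3) %/ 4)%Z; clear -f3; lia.
exists lambda; split; first exact/lamE.
have cP : #|P| = f by rewrite P_def (card_cyclotomic_class q_f zP).
have Msum : 2 * (class_pairs f (1 : F) + class_pairs f (z ^+ f)) = f%:Z - 1.
  by rewrite -natz; exact: class_pairs_sum q_f zP f_odd.
(* With s = 5, 16 M(1) = 4(f + 1) = 16(lambda + 1); then [Msum] leaves lambda for the other
   class. *)
have M1' : class_pairs f (1 : F) = lambda + 1 by clear -M1 lam4 s5; lia.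
have Mi : class_pairs f (z ^+ f) = lambda.
  by clear -Msum M1' lam4; lia.
split; first by rewrite card_F.
  exists P, [set 0]; split=> //; last by rewrite cP cards1.
  rewrite disjoint_sym disjoints1 PE inE expr0n (gtn_eqF (f_gt0 zP)) eq_sym.
  exact: c0.
apply/ffunP => g; rewrite rhsE; have [->|g0] := eqVneq g 0.
  by rewrite (class_diff_coef0 zP c0 PE) cP; clear; lia.
rewrite (class_diff_coef zP f_odd c0 PE) // mul0r addr0.
have u0 : z ^+ i / g != 0 by rewrite mulf_neq0 ?invr_eq0 ?expf_neq0.
have := prim_expf_cases q_f zP u0; rewrite exprMn exprVn.
have := prim_quarter_uniq q_f zP; rewrite /= !inE !negb_or.
move=> /and4P[/and3P[n12 n13 n14] /andP[n23 n24] _ _].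
(* For e = 1 or -1 exactly one correction lowers lambda + 1 to lambda; for the other two values
   there is no correction. *)
case/or4P => /eqP->; rewrite ?class_pairsN //.
- by rewrite M1' eqxx (negPf n12) subr0 addrK.
- by rewrite M1' eqxx (eq_sym (-1)) (negPf n12) subr0 addrK.
- by rewrite Mi (eq_sym _ 1) (eq_sym _ (-1)) (negPf n13) (negPf n23) !subr0.
- by rewrite Mi (eq_sym _ 1) (eq_sym _ (-1)) (negPf n14) (negPf n24) !subr0.
Qed.
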